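(* Let $G$ be a finite complete multipartite graph with at least two partite sets and of diameter $2$ (equivalently, at least one partite set contains at least two vertices). Then $G$ is not $\{2\}$-distance magic.
   Context: Let $G=(V,E)$ be a finite simple undirected graph with $v=|V|$ vertices, and let $d(x,y)$ be the graph distance. For a set $D$ of nonnegative integers and $x\in V$, put $N_D(x)=\{y\in V : d(x,y)\in D\}$. A $D$-distance magic labeling of $G$ is a bijection $f:V\to\{1,2,\ldots,v\}$ for which there is a constant $\mathsf{k}$ such that $\sum_{y\in N_D(x)} f(y)=\mathsf{k}$ for every $x\in V$. $G$ is called $D$-distance magic if it admits a $D$-distance magic labeling. *)

(* Defs.v *)
(* MathComp world.  A simple graph on the finite vertex type T is a symmetric
   and irreflexive relation e : rel T. *)
From mathcomp Require Import all_boot.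

Set Implicit Arguments.
Unset Strict Implicit.
Unset Printing Implicit Defensive.

Section Graphs.

Variables (T : finType) (e : rel T).
Implicit Types (x y : T) (D : {pred nat}) (f : T -> nat).

Definition walk n x y : bool :=
  [exists p : n.-tuple T, path e x p && (last x p == y)].

(* None stands for infinite distance.  Since a shortest walk repeats no vertex,
   the search can stop at #|T|; see gdist_SomeP and gdist_NoneP. *)
Definition gdist x y : option nat :=
  ohead [seq n <- iota 0 #|T| | walk n x y].

(* None stands for infinite diameter. *)
Definition diameter : option nat :=
  if [forall x, forall y, gdist x y != None]
  then Some (\max_x \max_y odflt 0 (gdist x y))
  else None.

Definition dist_nbhd D x : {set T} :=
  [set y | if gdist x y is Some n then n \in D else false].

Definition labeling f : Prop :=
  [/\ injective f,
      forall x, 1 <= f x <= #|T|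
    & forall m, 1 <= m <= #|T| -> exists x, f x = m].

Definition distance_magic_labeling D f : Prop :=
  labeling f /\ exists k, forall x, \sum_(y in dist_nbhd D x) f y = k.

Definition distance_magic D : Prop :=
  exists f, distance_magic_labeling D f.

(* The blocks of a partition are nonempty, so #|P| counts the partite sets. *)
Definition complete_multipartite (P : {set {set T}}) : Prop :=
  partition P [set: T] /\
  forall x y, e x y = (pblock P x != pblock P y).

Lemma walkP n x y :
  reflect (exists p, [/\ path e x p, last x p = y & size p = n]) (walk n x y).
Proof.
apply: (iffP existsP) => [[p /andP[pP /eqP lp]]|[p [pP lp sp]]].
  by exists p; rewrite size_tuple.
have sp' : size p == n by apply/eqP.
by exists (Tuple sp'); rewrite /= pP lp eqxx.
Qed.

Lemma walk_short n x y : walk n x y ->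
  exists m, [/\ m < #|T|, m <= n & walk m x y].
Proof.
move=> wn; case: (ltnP n #|T|) => [ltn|len]; first by exists n.
case/walkP: wn => p [pP lp sp]; case: (shortenP pP) lp => q qP uq _ lq.
have szq : size q < #|T|.
  by have /card_uniqP/= <- := uq; apply: max_card.
exists (size q); split=> //; first exact: ltnW (leq_trans szq len).
by apply/walkP; exists q.
Qed.

Lemma ohead_filter_iota (a : pred nat) m k n :
  ohead [seq i <- iota m k | a i] = Some n ->
  [/\ a n, n < m + k & forall i, m <= i -> a i -> n <= i].
Proof.
elim: k m => [|k IH] m //=; case: ifP => [am /= [<-]|am /IH[an lt mn]].
  by rewrite addnS ltnS leq_addr; split.
rewrite addnS -addSn; split=> // i; rewrite leq_eqVlt => /orP[/eqP<-|].
  by rewrite am.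
exact: mn.
Qed.

Lemma gdist_SomeP x y n :
  gdist x y = Some n <-> walk n x y /\ forall m, walk m x y -> n <= m.
Proof.
have aux k : gdist x y = Some k ->
    walk k x y /\ forall m, walk m x y -> k <= m.
  by case/ohead_filter_iota => wk _ mk; split=> // m; apply: mk.
split=> [/aux //|[wn mn]]; case E: (gdist x y) => [k|].
  by have [wk mk] := aux _ E; congr Some; apply/eqP; rewrite eqn_leq mk ?mn.
have [m [ltm _ wm]] := walk_short wn.
have : m \in [seq i <- iota 0 #|T| | walk i x y].
  by rewrite mem_filter wm mem_iota.
by move: E; rewrite /gdist; case: [seq _ <- _ | _].
Qed.

Lemma gdist_NoneP x y : gdist x y = None <-> forall n, ~~ walk n x y.
Proof.
split=> [E n|nw].
  apply/negP => /walk_short[m [ltm _ wm]].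
  have : m \in [seq i <- iota 0 #|T| | walk i x y].
    by rewrite mem_filter wm mem_iota.
  by move: E; rewrite /gdist; case: [seq _ <- _ | _].
case E: (gdist x y) => [k|] //; have /gdist_SomeP[wk _] := E.
by have := nw k; rewrite wk.
Qed.

End Graphs.

(* Main.v *)
Require Import Defs.
From mathcomp Require Import all_boot.

(** In a complete multipartite graph with at least two partite sets, two
    distinct vertices are adjacent when they lie in different parts, and
    otherwise have a common neighbour, namely any vertex of another part.
    Hence all distances are at most 2, and the vertices at distance 2 from [x]
    are the other members of the part of [x] ([dist_nbhd2_multipartite]).  This
    gives the diameter.

    For the labeling, let [x] and [y] be distinct vertices of one part [A].
    The sums of [f] over [A] minus [x] and over [A] minus [y] are both the
    magic constant; since adding [f x] to the first and [f y] to the second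
    gives the sum over [A], it follows that [f x = f y], which contradicts the
    injectivity of [f]. *)

Lemma walk0E (T : finType) (e : rel T) x y : walk e 0 x y = (x == y).
Proof.
apply/walkP/eqP => [[p [_ <- /size0nil->]] // | ->].
by exists [::].
Qed.

Lemma walk1E (T : finType) (e : rel T) x y : walk e 1 x y = e x y.
Proof.
apply/walkP/idP => [[p [pP lp sp]] | exy].
  by case: p pP lp sp => [|z [|? ?]] //=; rewrite andbT => exz <-.
by exists [:: y]; rewrite /= exy.
Qed.

Lemma gdist_common_neighbour (T : finType) (e : rel T) x y :
    (x != y -> ~~ e x y -> exists z, e x z && e z y) ->
  gdist e x y = Some (if x == y then 0 else if e x y then 1 else 2).
Proof.
move=> nbr; apply/gdist_SomeP.
have [->|neq_xy] := eqVneq x y; first by rewrite walk0E.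
have [exy|nexy] := boolP (e x y).
  by rewrite walk1E; split=> // -[|m] //; rewrite walk0E (negPf neq_xy).
split=> [|[|[|m]] //]; last first.
- by rewrite walk1E (negPf nexy).
- by rewrite walk0E (negPf neq_xy).
have [z /andP[exz ezy]] := nbr neq_xy nexy.
by apply/walkP; exists [:: z; y]; rewrite /= exz ezy.
Qed.

Section CompleteMultipartite.

Variables (T : finType) (e : rel T) (P : {set {set T}}).
Hypotheses (e_cm : complete_multipartite e P) (P_gt1 : 1 < #|P|).

Let trivP : trivIset P. Proof. by have [/and3P[]] := e_cm. Qed.

Let coverP x : x \in cover P.
Proof. by have [/and3P[/eqP-> _ _] _] := e_cm; rewrite inE. Qed.

Lemma exists_other_part x : exists z, pblock P x != pblock P z.
Proof.
have [B BP neqB] : exists2 B, B \in P & pblock P x != B.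
  have [B [C [BP CP neqBC]]] := card_gt1P P_gt1.
  have [eqB|neqB] := eqVneq (pblock P x) B; last by exists B.
  by exists C; rewrite // eqB.
have [/and3P[_ _ P0] _] := e_cm.
have [B0|[z zB]] := set_0Vmem B; first by rewrite -B0 BP in P0.
by exists z; rewrite (def_pblock trivP BP zB).
Qed.

Lemma gdist_multipartite x y :
  gdist e x y =
    Some (if x == y then 0 else if pblock P x != pblock P y then 1 else 2).
Proof.
have [_ eE] := e_cm.
rewrite -eE; apply: gdist_common_neighbour => _.
rewrite eE negbK => /eqP eq_xy; have [z neq_xz] := exists_other_part x.
by exists z; rewrite !eE -eq_xy neq_xz eq_sym neq_xz.
Qed.

Lemma dist_nbhd2_multipartite x :
  dist_nbhd e (pred1 2) x = pblock P x :\ x.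
Proof.
apply/setP=> y; rewrite !inE gdist_multipartite (eq_sym y) -eq_pblock //.
by case: eqP => //= _; case: eqP.
Qed.

Lemma gdist2_multipartite x y :
  gdist e x y = Some 2 <-> y \in pblock P x :\ x.
Proof.
rewrite -dist_nbhd2_multipartite inE.
by case: gdist => [n|] //; split=> [[->]|/eqP->].
Qed.

Lemma diameter_multipartite :
  diameter e = Some 2 <-> exists x y, gdist e x y = Some 2.
Proof.
rewrite /diameter ifT; last first.
  by apply/forallP=> x; apply/forallP=> y; rewrite gdist_multipartite.
split=> [[max2]|[x [y dxy]]].
  have [/existsP[x /existsP[y /eqP dxy]]|no2] :=
    boolP [exists x, exists y, gdist e x y == Some 2]; first by exists x, y.
  suff: \max_x \max_y odflt 0 (gdist e x y) <= 1 by rewrite max2.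
  apply/bigmax_leqP=> x _; apply/bigmax_leqP=> y _.
  move: no2; rewrite negb_exists => /forallP/(_ x).
  rewrite negb_exists => /forallP/(_ y).
  by rewrite gdist_multipartite; case: ifP => // _; case: ifP.
congr Some; apply/eqP; rewrite eqn_leq; apply/andP; split.
  apply/bigmax_leqP=> x' _; apply/bigmax_leqP=> y' _.
  by rewrite gdist_multipartite; case: ifP => // _; case: ifP.
by apply: (bigmax_sup x) => //; apply: (bigmax_sup y); rewrite // dxy.
Qed.

(** Each [f x] is what the neighbourhood sum at [x] lacks from the sum over the
    whole part, so a constant neighbourhood sum makes [f] constant on parts. *)
Lemma magic2_constant_on_part (f : T -> nat) k x y :
    (forall z, \sum_(t in dist_nbhd e (pred1 2) z) f t = k) ->
  pblock P x = pblock P y -> f x = f y.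
Proof.
move=> magic eq_xy.
have part_sum z : \sum_(t in pblock P z) f t = f z + k.
  rewrite (big_setD1 z) /=; last by rewrite mem_pblock.
  by rewrite -(magic z) dist_nbhd2_multipartite.
by apply: (@addIn k); rewrite -!part_sum eq_xy.
Qed.

End CompleteMultipartite.

Theorem theorem7 (T : finType) (e : rel T) (P : {set {set T}})
    (e_sym : symmetric e) (e_irr : irreflexive e)
    (e_cm : complete_multipartite e P) (P_gt1 : 1 < #|P|) :
  (diameter e = Some 2 <-> exists2 A : {set T}, A \in P & 1 < #|A|) /\
  (diameter e = Some 2 -> ~ distance_magic e (pred1 2)).
Proof.
have [/and3P[/eqP covP trivP _] _] := e_cm.
have inP x : x \in cover P by rewrite covP inE.
have diamP := diameter_multipartite T e P e_cm P_gt1.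
have dist2P := gdist2_multipartite T e P e_cm P_gt1.
split; first split.
- move=> /diamP[x [y /dist2P]]; rewrite !inE => /andP[neq_yx yPx].
  exists (pblock P x); first by rewrite pblock_mem.
  by apply/card_gt1P; exists y, x; rewrite yPx mem_pblock inP.
- move=> [A AP /card_gt1P[x [y [xA yA neq_xy]]]]; apply/diamP; exists x, y.
  by apply/dist2P; rewrite !inE eq_sym neq_xy (def_pblock trivP AP xA).
move=> /diamP[x [y /dist2P]]; rewrite !inE => /andP[/eqP neq_yx yPx].
move=> [f [[f_inj _ _] [k magic]]]; apply/neq_yx/f_inj.
apply: (magic2_constant_on_part T e P e_cm P_gt1 f k) magic _.
by apply/esym/eqP; rewrite eq_pblock.
Qed.
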